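(* Let $p$ be a prime, let $d$ be a positive integer with $d<p$, and let $1\leq R\leq L\leq n$ be integers. Then the locus of polynomial maps $P\in\mathcal{P}(n,d)^R$ such that $\dim S_P^*\geq L$ is contained in an algebraic subset of $\mathcal{P}(n,d)^R$ of codimension at least $L-2R+2$.
   Context: $\bar{\mathbb{F}}_p$ denotes the algebraic closure of $\mathbb{F}_p$. $\mathcal{P}(n,d)$ is the space of homogeneous polynomials $P:\bar{\mathbb{F}}_p^n\to\bar{\mathbb{F}}_p$ of degree $d$ (including zero), a linear space over $\bar{\mathbb{F}}_p$ of dimension $\binom{n+d-1}{d}$. $\mathcal{P}(n,d)^R$ is the space of $R$-tuples $P=(P_1,\ldots,P_R)$ of such polynomials, viewed as an affine space over $\bar{\mathbb{F}}_p$; codimension is taken in this affine space. For $P\in\mathcal{P}(n,d)^R$, $$S_P^*=\{x\in\bar{\mathbb{F}}_p^n:\ \operatorname{rank}(Jac_P(x))<R\},$$ where $Jac_P(x)$ is the $R\times n$ matrix with entries $\partial_{x_j}P_i(x)$, and $\dim S_P^*$ is its dimension as an algebraic subset of $\bar{\mathbb{F}}_p^n$. *)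

(* Defs.v *)
From HB Require Import structures.
From mathcomp Require Import all_boot all_order all_algebra all_field.
From mathcomp Require Import classical_sets.
From mathcomp Require Import mpoly.

Set Implicit Arguments.
Unset Strict Implicit.
Unset Printing Implicit Defensive.

Import GRing.Theory.

Local Open Scope ring_scope.
Local Open Scope classical_set_scope.

Lemma hpoly_vecaxiom (n : nat) (K : fieldType) (d : nat) :
  Vector.axiom 'C((n + d).-1, d) (dhomog n K d).
Proof.
case: n => [|m]; last first.
  by rewrite addSn /= addnC; exact: dhomog_vecaxiom.
have mE (x : 'X_{1..0}) : x = 0%MM by apply/mnmP; case.
have d0 (p : dhomog 0 K d) : (0 < d)%N -> p = 0.
  move=> d_gt0; apply/val_inj/mpolyP => x /=; rewrite mcoeff0.
  apply: (@dhomog_nemf_coeff _ _ mdeg d); first exact: dhomog_is_dhomog.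
  suff: mdeg x != d by []; by rewrite mdegE big_ord0 neq_ltn d_gt0.
pose f (p : dhomog 0 K d) : 'rV[K]_('C(d.-1, d)) :=
  \row_i (val p)@_0%MM.
exists f => [c p q|].
  by apply/rowP => i; rewrite !mxE /= mcoeffD mcoeffZ.
have [d_gt0|] := ltnP 0 d.
  have C0 : 'C(d.-1, d) = 0%N by rewrite bin_small // prednK.
  exists (fun=> 0) => [p|r]; first by rewrite [p]d0.
  by apply/rowP => -[i lt_i]; exfalso; move: lt_i; rewrite C0.
rewrite leqn0 => /eqP d_eq0; subst d.
have hom (c : K) : c%:MP_[0] \is 0.-homog.
  by rewrite -[c%:MP]mulr1 mul_mpolyC rpredZ // dhomog1.
exists (fun r : 'rV_1 => DHomog (hom (r 0 0))) => [p|r].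
  apply/val_inj/mpolyP => x /=.
  by rewrite (mE x) mcoeffC eqxx mulr1 mxE.
by apply/rowP => i; rewrite !mxE /= mcoeffC eqxx mulr1 !ord1.
Qed.

Section HomogeneousPolynomials.
Context (n : nat) (K : fieldType) (d : nat).

(* A synonym of [dhomog], which mpoly.v makes a vectType only when the number
   of variables is syntactically a successor. *)
Definition hpoly : Type := dhomog n K d.

HB.instance Definition _ := GRing.Lmodule.on hpoly.
HB.instance Definition _ := SubType.on hpoly.

HB.instance Definition _ := Lmodule_hasFinDim.Build K hpoly
  (hpoly_vecaxiom n K d).

Definition polymap (R : nat) : Type := {ffun 'I_R -> hpoly}.

HB.instance Definition _ (R : nat) := Vector.on (polymap R).

End HomogeneousPolynomials.

(* The Zariski topology of a finite-dimensional K-vector space, seen as an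
   affine space.  Polynomial functions are polynomials in the coordinates with
   respect to a basis; the closed sets do not depend on the basis. *)
Section Zariski.
Context (K : fieldType) (V : vectType K).
Implicit Types A B Y : set V.

Definition coords (v : V) : 'I_(\dim {:V}) -> K :=
  fun i => coord (vbasis {:V}) i v.

Definition algebraic A : Prop :=
  exists S : set {mpoly K[\dim {:V}]},
    A = [set v | forall f, S f -> f.@[coords v] = 0].

Definition irreducible_closed Y : Prop :=
  [/\ algebraic Y, Y !=set0 &
      forall A B, algebraic A -> algebraic B ->
        Y = A `|` B -> Y = A \/ Y = B].

(* dim A >= k, for A algebraic and dim the Krull dimension: A contains a chain
   Z 0 < Z 1 < ... < Z k of irreducible closed sets (so dim set0 = -oo). *)
Definition dim_geq A (k : nat) : Prop :=
  exists Z : nat -> set V,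
    (forall i, (i <= k)%N -> irreducible_closed (Z i) /\ Z i `<=` A) /\
    (forall i, (i < k)%N -> Z i `<` Z i.+1).

(* codim A >= c, i.e. dim A + c <= dim V, with codim set0 = +oo.  The bound c
   may be negative. *)
Definition codim_geq A (c : int) : Prop :=
  forall k, dim_geq A k ->
    exists2 N, dim_geq [set: V] N & k%:Z + c <= N%:Z.

End Zariski.

Section SingularLocus.
Context (K : fieldType) (n d R : nat).

Definition jacobian (P : polymap n K d R) (x : 'rV[K]_n) : 'M[K]_(R, n) :=
  \matrix_(i < R, j < n) ((val (P i))^`M(j)).@[fun k => x 0 k].

Definition Sstar (P : polymap n K d R) : set 'rV[K]_n :=
  [set x | (\rank (jacobian P x) < R)%N].

End SingularLocus.

(* Main.v *)
(* If x lies in S_P^*, some covector l <> 0 satisfies sum_i l_i dP_i(x) = 0.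
   Scaling y = x / x_j and l so that y_j = 1 and l_i0 = 1, these are n
   independent equations on the coefficients of x_j^(d-1) x_1, ..., x_j^(d-1) x_n
   in P_i0, as d is invertible in K.  So the incidence set {(P, x) | x in S_P^*},
   restricted to those P with S_P^* <> {0}, is covered by finitely many
   polynomial images of affine space of dimension m = dim V + R - 1, where
   V = P(n,d)^R.

   Dimension is measured by algebraically independent functions.  A chain of
   length k of irreducible closed sets in a set A gives k polynomials that are
   algebraically independent on A; and on a set A of K^n, k independent
   polynomials give k independent coordinates.  Take for Z the Zariski closure
   of T = {P | dim S_P^* >= L}, and suppose that Z has a chain of length k, so
   that k polynomials u_i(P) are independent on T.  As there are finitely many
   sets of L coordinates, the u_i are independent on the set of those P in T
   for which one fixed set of L coordinates x_j is independent on S_P^*.  Then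
   the k + L functions u_i(P), x_j are independent on the incidence set, hence
   k + L <= m, i.e. codim Z >= L - R + 1.  Working with independent functions
   rather than with points of fibres makes the Nullstellensatz unnecessary. *)

Require Import Defs.
From HB Require Import structures.
From mathcomp Require Import all_boot all_order all_algebra all_field.
From mathcomp Require Import boolp classical_sets.
From mathcomp Require Import mpoly.
From mathcomp Require Import ring zify.

Set Implicit Arguments.
Unset Strict Implicit.
Unset Printing Implicit Defensive.

Import Order.TTheory GRing.Theory.

Local Open Scope ring_scope.
Local Open Scope classical_set_scope.

(** * Algebraic independence and chains of irreducible closed sets *)

(** The set [A] need be neither closed nor irreducible. For [k = 0] the condition says that [A] is
    nonempty. *)
Definition alg_indep (K : fieldType) (X : Type) (A : set X) k
    (u : 'I_k -> X -> K) : Prop :=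
  forall h : {mpoly K[k]}, (forall x, A x -> h.@[u^~ x] = 0) -> h = 0.

Lemma alg_indepS (K : fieldType) (X : Type) (A B : set X) k
    (u : 'I_k -> X -> K) :
  A `<=` B -> alg_indep A u -> alg_indep B u.
Proof. by move=> AB indA h h0; apply: indA => x /AB; exact: h0. Qed.

Section Extension.
Context (K : fieldType) (X : Type) (A B : set X) (k : nat).
Variables (u : 'I_k -> X -> K) (g : X -> K).

Definition extend_family (i : 'I_k.+1) : X -> K :=
  if unlift ord0 i is Some j then u j else g.

Hypothesis AB : A `<=` B.
Hypothesis u_indep : alg_indep A u.
Hypothesis g0 : forall x, A x -> g x = 0.
Hypothesis g_reg : forall h : {mpoly K[k.+1]},
  (forall x, B x -> g x * h.@[extend_family^~ x] = 0) ->
  forall x, B x -> h.@[extend_family^~ x] = 0.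

Let rest (m : 'X_{1..k.+1}) : 'X_{1..k} := [multinom m (lift ord0 i) | i < k].

Let rest_inj (m m' : 'X_{1..k.+1}) :
  m ord0 = 0%N -> m' ord0 = 0%N -> rest m = rest m' -> m = m'.
Proof.
move=> m0 m'0 /mnmP e; apply/mnmP => i.
by case: (unliftP ord0 i) => [j|] ->; [move: (e j); rewrite !mnmE | rewrite m0].
Qed.

Let meval_extend (h : {mpoly K[k.+1]}) x : h.@[extend_family^~ x] =
  \sum_(m <- msupp h) h@_m * (g x ^+ m ord0 * \prod_i u i x ^+ rest m i).
Proof.
rewrite mevalE; apply: eq_bigr => m _; congr (_ * _).
rewrite big_ord_recl /extend_family unlift_none; congr (_ * _).
by apply: eq_bigr => i _; rewrite liftK mnmE.
Qed.

(** On [A], where [g] vanishes, only the monomials free of ['X_ord0] survive, and they form a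
    relation among the [u i]. *)
Let coef_ord0_eq0 (h : {mpoly K[k.+1]}) :
  (forall x, B x -> h.@[extend_family^~ x] = 0) ->
  forall m : 'X_{1..k.+1}, m ord0 = 0%N -> h@_m = 0.
Proof.
move=> h0 m m0.
pose h1 : {mpoly K[k]} :=
  \sum_(l <- msupp h | l ord0 == 0%N) h@_l *: 'X_[rest l].
have h1_0 : h1 = 0.
  apply: u_indep => x Ax; rewrite -[RHS](h0 x (AB Ax)) meval_extend /h1.
  rewrite raddf_sum /= [RHS](bigID (fun l : 'X_{1..k.+1} => l ord0 == 0%N)) /=.
  rewrite [X in _ = _ + X]big1 ?addr0 => [|l /negPf l0]; last first.
    by rewrite g0 // expr0n l0 mul0r mulr0.
  by apply: eq_bigr => l /eqP ->; rewrite mevalZ mevalX expr0 mul1r.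
have [mh|] := boolP (m \in msupp h); last by rewrite mcoeff_msupp negbK => /eqP.
have /(congr1 (mcoeff (rest m))) := h1_0.
rewrite mcoeff0 raddf_sum /= -big_filter (bigD1_seq m) /=; last 2 first.
- by rewrite mem_filter m0 eqxx.
- by rewrite filter_uniq ?msupp_uniq.
rewrite big_filter_cond big1 => [|l /andP[/eqP l0 lm]]; last first.
  rewrite mcoeffZ mcoeffX; case: eqP => [/rest_inj lm'|]; last by rewrite mulr0.
  by rewrite lm' // eqxx in lm.
by rewrite addr0 mcoeffZ mcoeffX eqxx mulr1.
Qed.

(** By [coef_ord0_eq0] a relation is divisible by ['X_ord0]. By [g_reg] the quotient is again a
    relation, of smaller degree, and induction on the size applies. *)
Lemma alg_indep_extend : alg_indep B extend_family.
Proof.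
move=> h; have [s] := ubnP (msize h); elim: s h => // s IH h hs h0.
have m_gt0 (m : 'X_{1..k.+1}) : m \in msupp h -> (0 < m ord0)%N.
  by rewrite mcoeff_msupp lt0n; apply: contraNneq => m0; rewrite coef_ord0_eq0.
pose h' : {mpoly K[k.+1]} := \sum_(l <- msupp h) h@_l *: 'X_[l - U_(ord0)].
have hE : h = 'X_ord0 * h'.
  rewrite {1}[h]mpolyE mulr_sumr big_seq [RHS]big_seq.
  apply: eq_bigr => l lh; rewrite -scalerAr -mpolyXD; congr (_ *: 'X_[_]).
  rewrite addmC submK //; apply/mnm_lepP => i; rewrite mnm1E.
  by case: eqP => // <-; exact: m_gt0.
suff h'0 : h' = 0 by rewrite hE h'0 mulr0.
have [//|h'_neq0] := eqVneq h' 0.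
have X_neq0 : 'X_ord0 != 0 :> {mpoly K[k.+1]}.
  by rewrite -msize_poly_eq0 msizeX.
apply: IH.
  by move: hs; rewrite {1}hE msizeM // msizeX mdeg1.
apply: g_reg => x Bx; rewrite -[RHS](h0 x Bx) [in RHS]hE mevalM mevalXU.
by rewrite /extend_family unlift_none.
Qed.

End Extension.

Section ZariskiDimension.
Context (K : fieldType) (V : vectType K).
Implicit Types A B Y : set V.

Lemma algebraic_cut A (f : {mpoly K[\dim {:V}]}) :
  algebraic A -> algebraic (A `&` [set v | f.@[coords v] = 0]).
Proof.
move=> [S ->]; exists (S `|` [set f]); apply/seteqP; split=> [v [Sv fv] g|v Sv].
  by case=> [/Sv|->].
by split=> [g Sg|]; apply: Sv; [left|right].
Qed.

(** The ideal of [Y] is prime, because [Y] is the union of its intersections with the zero sets of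
    [f] and [g]. *)
Lemma irreducible_closed_mul Y (f g : {mpoly K[\dim {:V}]}) :
  irreducible_closed Y ->
  (forall v, Y v -> f.@[coords v] * g.@[coords v] = 0) ->
  (forall v, Y v -> f.@[coords v] = 0) \/ (forall v, Y v -> g.@[coords v] = 0).
Proof.
move=> [algY _ irrY] fg0.
have := irrY _ _ (algebraic_cut f algY) (algebraic_cut g algY).
case=> [|YE|YE].
- apply/seteqP; split=> v; last by case=> -[].
  move=> Yv; have /eqP := fg0 v Yv.
  by rewrite mulf_eq0 => /orP[/eqP|/eqP] ?; [left|right].
- by left=> v; rewrite YE => -[].
- by right=> v; rewrite YE => -[].
Qed.

Lemma algebraic_separated A v : algebraic A -> ~ A v ->
  exists2 f : {mpoly K[\dim {:V}]},
    forall w, A w -> f.@[coords w] = 0 & f.@[coords v] != 0.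
Proof.
move=> [S ->] /existsNP[f /not_implyP[Sf /eqP fv]].
by exists f => // w; apply.
Qed.

(** Each step of the chain adds one function: a polynomial [g] that vanishes on [Z i] but not on all
    of [Z i.+1]. As the ideal of [Z i.+1] is prime, [g] can be cancelled there, which is what
    [alg_indep_extend] requires. *)
Lemma dim_geq_alg_indep A k : dim_geq A k ->
  exists u : 'I_k -> {mpoly K[\dim {:V}]},
    alg_indep A (fun i v => (u i).@[coords v]).
Proof.
move=> [Z [Zirr Zlt]].
suff /(_ k (leqnn k))[u u_indep] : forall i, (i <= k)%N ->
    exists u : 'I_i -> {mpoly K[\dim {:V}]},
      alg_indep (Z i) (fun j v => (u j).@[coords v]).
  by exists u; apply: alg_indepS u_indep; have [] := Zirr k (leqnn k).
elim=> [|i IH] ik.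
  have [[_ [v Zv] _] _] := Zirr 0%N ik.
  exists (fun=> 0) => h /(_ v Zv).
  have [c ->] : exists c, h = c%:MP.
    by exists h@_0%MM; exact: nvar0_mpolyC.
  by rewrite mevalC => ->.
have [u u_indep] := IH (ltnW ik).
have [irrZ _] := Zirr _ ik; have [[algZ _ _] _] := Zirr _ (ltnW ik).
have [ZZ /existsNP[v /not_implyP[Zv nZv]]] := Zlt i ik.
have [g g0 gv] := algebraic_separated algZ nZv.
pose u' j := if unlift ord0 j is Some l then u l else g.
exists u'.
have -> : (fun j v => (u' j).@[coords v]) =
    extend_family (fun j v => (u j).@[coords v]) (fun v => g.@[@coords K V v]).
  apply/funext => j; apply/funext => w.
  by rewrite /u' /extend_family; case: unlift.
apply: (alg_indep_extend ZZ) => // h.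
have hE w : h.@[(extend_family (fun j v => (u j).@[coords v])
    (fun v => g.@[@coords K V v]))^~ w] =
    (h \mPo [tuple u' j | j < i.+1]).@[coords w].
  rewrite comp_mpoly_meval; apply: meval_eq => j.
  by rewrite tnth_mktuple /u' /extend_family; case: unlift.
move=> gh0; have [|/(_ v Zv) /eqP|h0 w Zw] := irreducible_closed_mul (f := g)
  (g := h \mPo [tuple u' j | j < i.+1]) irrZ.
- by move=> w Zw; rewrite -hE; exact: gh0.
- by rewrite (negPf gv).
- by rewrite hE; exact: h0.
Qed.

End ZariskiDimension.

(** * Dependence by counting *)

Lemma kernel_exists (K : fieldType) (I J : finType) (M : I -> J -> K) :
  (#|J| < #|I|)%N ->
  exists2 c : I -> K, exists i, c i != 0 &
    forall j, \sum_i c i * M i j = 0.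
Proof.
move=> ltJI; pose A := \matrix_(i < #|I|, j < #|J|) M (enum_val i) (enum_val j).
have : kermx A != 0.
  rewrite -mxrank_eq0 mxrank_ker subn_eq0 -ltnNge.
  exact: leq_ltn_trans (rank_leq_col A) _.
move/rowV0Pn => [v /sub_kermxP vA /rV0Pn[i vi]].
exists (fun i => v 0 (enum_rank i)) => [|j].
  by exists (enum_val i); rewrite enum_valK.
have /rowP/(_ (enum_rank j)) := vA; rewrite !mxE => e; rewrite -[RHS]e.
rewrite (reindex _ (onW_bij _ (enum_val_bij I))) /=.
by apply: eq_bigr => k _; rewrite mxE !enum_rankK enum_valK.
Qed.

(** The inequality behind both counting arguments: [e ^ k] products of degree [O(e)] outnumber the
    available [O(e ^ m)] coefficients. It is enough that [e] exceeds [C * N ^ m]. *)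
Lemma pow_lt_exists (C N m k : nat) : (m < k)%N ->
  exists2 e, (0 < e)%N & (C * (N * e) ^ m < e ^ k)%N.
Proof.
move=> ltmk; pose e := (C * N ^ m).+1; exists e => //.
apply: (@leq_trans (e ^ m.+1)%N); last by rewrite leq_pexp2l.
by rewrite expnMn mulnA expnS ltn_mul2r expn_gt0 /= ltnS leqnn.
Qed.

Section MonomialDegree.
Context (R : idomainType) (n : nat).
Implicit Types p q : {mpoly R[n]}.

Lemma msize_mul_deg p q a b :
  (msize p <= a.+1 -> msize q <= b.+1 -> msize (p * q) <= (a + b).+1)%N.
Proof.
move=> pa qb; have [->|p0] := eqVneq p 0; first by rewrite mul0r msize0.
have [->|q0] := eqVneq q 0; first by rewrite mulr0 msize0.
rewrite msizeM // -subn1 leq_subLR; apply: leq_trans (leq_add pa qb) _.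
by rewrite addSn addnS.
Qed.

Lemma msize_exp_deg p a l : (msize p <= a.+1 -> msize (p ^+ l) <= (l * a).+1)%N.
Proof.
move=> pa; elim: l => [|l IH]; first by rewrite expr0 msize1.
by rewrite exprS mulSn msize_mul_deg.
Qed.

(** The degree is at most [k * N * e.-1]. The bound is relaxed to a multiple of [e], the shape used
    in [pow_lt_exists]. *)
Lemma msize_monomial_deg k (q : 'I_k -> {mpoly R[n]}) (a : 'I_k -> nat) N e :
  (forall i, msize (q i) <= N.+1)%N -> (forall i, a i < e)%N -> (0 < e)%N ->
  (msize (\prod_i q i ^+ a i) <= (k * N).+1 * e)%N.
Proof.
move=> qN ae e0.
suff H (r : seq 'I_k) :
    (msize (\prod_(i <- r) q i ^+ a i) <= (size r * e.-1 * N).+1)%N.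
  apply: leq_trans (H _) _; rewrite -[index_enum _]enumT size_enum_ord.
  case: e e0 {ae H} => // e _; rewrite /= mulSn addSn ltnS mulnAC.
  by apply: leq_trans (leq_addl _ _); rewrite leq_mul2l leqnSn orbT.
elim: r => [|i r IH]; first by rewrite big_nil msize1.
rewrite big_cons /= mulSn mulnDl msize_mul_deg //.
apply: leq_trans (msize_exp_deg _ (qN i)) _.
by rewrite ltnS leq_mul2r -ltnS prednK // ae orbT.
Qed.

End MonomialDegree.

Section Independence.
Context (K : fieldType) (X : Type).
Implicit Types A : set X.

Lemma alg_indep_monomials A k (u : 'I_k -> X -> K) e
    (c : {ffun 'I_k -> 'I_e} -> K) :
  alg_indep A u ->
  (forall x, A x -> \sum_a c a * \prod_i u i x ^+ a i = 0) ->
  forall a, c a = 0.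
Proof.
move=> u_indep c0 a.
pose mon (b : {ffun 'I_k -> 'I_e}) : 'X_{1..k} := [multinom val (b i) | i < k].
have mon_inj : injective mon.
  move=> b b' /mnmP bb'; apply/ffunP => i; apply: val_inj.
  by have := bb' i; rewrite !mnmE.
have /(congr1 (mcoeff (mon a))) : \sum_b c b *: 'X_[mon b] = 0 :> {mpoly K[k]}.
  apply: u_indep => x Ax; rewrite -[RHS](c0 x Ax) raddf_sum.
  apply: eq_bigr => b _; rewrite /= mevalZ mevalX; congr (_ * _).
  by apply: eq_bigr => i _; rewrite mnmE.
rewrite mcoeff0 raddf_sum (bigD1 a) //= big1 ?addr0.
  by rewrite mcoeffZ mcoeffX eqxx mulr1.
by move=> b /negPf ba; rewrite mcoeffZ mcoeffX (inj_eq mon_inj) ba mulr0.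
Qed.

(** A combination of the [F i] vanishes on [A] once its pullback to each chart is the zero
    polynomial. This imposes at most [#|C| * s ^ m] linear conditions on [#|I|] unknowns. *)
Lemma charts_dependent A (C I : finType) m s (F : I -> X -> K)
    (q : C -> I -> {mpoly K[m]}) :
  (forall c i, msize (q c i) <= s)%N ->
  (forall x, A x -> exists c t, forall i, F i x = (q c i).@[t]) ->
  (#|C| * s ^ m < #|I|)%N ->
  exists2 a : I -> K, exists i, a i != 0 &
    forall x, A x -> \sum_i a i * F i x = 0.
Proof.
move=> qs Fq ltCI.
pose M i (j : C * {ffun 'I_m -> 'I_s}) :=
  (q j.1 i)@_[multinom val (j.2 l) | l < m].
have [|a a0 aM] := @kernel_exists K I _ M.
  by rewrite card_prod card_ffun !card_ord.
exists a => // x Ax; have [c [t Ft]] := Fq x Ax.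
under eq_bigr do rewrite Ft -mevalZ.
rewrite -raddf_sum /= [X in X.@[_]](_ : _ = 0) ?meval0 //.
apply/mpolyP => l; rewrite mcoeff0 raddf_sum /=.
have [ls|] := boolP [forall i, l i < s]%N.
  have ls' i : (l i < s)%N by move/forallP: ls.
  rewrite -[RHS](aM (c, [ffun i => Ordinal (ls' i)])); apply: eq_bigr => i _.
  rewrite mcoeffZ /M /=; congr (_ * _@__); apply/mnmP => j.
  by rewrite mnmE ffunE.
(* A monomial with an exponent at least [s] occurs in no [q c i], by the size bound. *)
rewrite negb_forall => /existsP[i]; rewrite -leqNgt => sl.
rewrite big1 // => j _; rewrite mcoeffZ (memN_msupp_eq0 (p := q c j)) ?mulr0 //.
apply: msize_mdeg_ge; apply: leq_trans (qs c j) _; apply: leq_trans sl _.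
by rewrite mdegE (bigD1 i) //= leq_addr.
Qed.

End Independence.

(* Division for the degree-lexicographic order of mpoly.v: a nonstandard leading
   monomial is a multiple of that of some H vanishing on A. *)
Lemma standard_reduction (K : fieldType) (X : Type) (A : set X) n
    (x : 'I_n -> X -> K) (std : pred 'X_{1..n}) s :
  (forall m, ~~ std m -> exists2 H : {mpoly K[n]},
     H != 0 /\ (mlead H <= m)%MM & forall v, A v -> H.@[x^~ v] = 0) ->
  forall p : {mpoly K[n]}, (msize p <= s)%N ->
  exists r : {mpoly K[n]},
    [/\ {in msupp r, forall m, std m}, (msize r <= s)%N &
        forall v, A v -> p.@[x^~ v] = r.@[x^~ v]].
Proof.
move=> nstd p; elim/mleadrect: p => p IH ps.
have [->|p0] := eqVneq p 0.
  by exists 0; rewrite msize0; split=> // m; rewrite msupp0.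
(* One division step: [q] has the leading term of [p] and agrees on [A] with the standard [r], so
   the induction hypothesis applies to [p - q]. *)
have step (q r : {mpoly K[n]}) :
    q != 0 -> mlead q = mlead p -> q@_(mlead p) = p@_(mlead p) ->
    {in msupp r, forall m, std m} -> (msize r <= s)%N ->
    (forall v, A v -> q.@[x^~ v] = r.@[x^~ v]) ->
  exists r : {mpoly K[n]},
    [/\ {in msupp r, forall m, std m}, (msize r <= s)%N &
        forall v, A v -> p.@[x^~ v] = r.@[x^~ v]].
  move=> q0 lq cq rstd rs qr.
  have pqs : (msize (p - q) <= s)%N.
    apply: leq_trans (mmeasureD_le _ _ _) _; rewrite mmeasureN geq_max ps.
    by rewrite -mlead_deg // lq mlead_deg.
  have [r' [r'std r's pr']] : exists r : {mpoly K[n]},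
    [/\ {in msupp r, forall m, std m}, (msize r <= s)%N &
        forall v, A v -> (p - q).@[x^~ v] = r.@[x^~ v]].
    have [pq0|pq0] := eqVneq (p - q) 0.
      by exists 0; rewrite pq0 msize0; split=> // m; rewrite msupp0.
    apply: IH => //; rewrite lt_neqAle.
    apply/andP; split; last first.
      apply: le_trans (mleadB_le _ _) _.
      by rewrite lq joinxx.
    by apply: contraNneq pq0 => e; rewrite -mleadc_eq0 e mcoeffB cq subrr.
  exists (r' + r); split=> [m /msuppD_le||v Av].
  - by rewrite mem_cat => /orP[/r'std|/rstd].
  - by apply: leq_trans (mmeasureD_le _ _ _) _; rewrite geq_max r's rs.
  - by rewrite mevalD -pr' // -qr // mevalB subrK.
have c0 : p@_(mlead p) != 0 by rewrite mleadc_eq0.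
have [std_p|/nstd[H [H0 Hp] HA]] := boolP (std (mlead p)).
  pose q : {mpoly K[n]} := p@_(mlead p) *: 'X_[mlead p].
  have lq : mlead q = mlead p by rewrite mleadZ // mleadXm.
  have q0 : q != 0.
    by rewrite -mleadc_eq0 lq mcoeffZ mcoeffX eqxx mulr1.
  apply: (step q q) => //.
  - by rewrite mcoeffZ mcoeffX eqxx mulr1.
  - by move=> m /msuppZ_le; rewrite msuppX inE => /eqP ->.
  - by rewrite -mlead_deg // lq mlead_deg.
have h0 : H@_(mlead H) != 0 by rewrite mleadc_eq0.
(* The multiple of [H] with the leading term of [p]; it vanishes on [A], so its standard form is
   0. *)
pose q := (p@_(mlead p) / H@_(mlead H)) *: ('X_[mlead p - mlead H] * H).
have X0 : 'X_[mlead p - mlead H] != 0 :> {mpoly K[n]}.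
  by rewrite -msize_poly_eq0 msizeX.
have cq0 : p@_(mlead p) / H@_(mlead H) != 0 by rewrite mulf_neq0 ?invr_eq0.
have lXH : mlead ('X_[mlead p - mlead H] * H) = mlead p.
  by rewrite mleadM // mleadXm submK.
have lq : mlead q = mlead p by rewrite mleadZ.
have q0 : q != 0 by rewrite scaler_eq0 negb_or cq0 mulf_neq0.
apply: (step q 0) => //.
- rewrite mcoeffZ [_ * H]mulrC -{2}(submK Hp) mcoeffMX.
  by rewrite divfK.
- by move=> m; rewrite msupp0.
- by rewrite msize0.
- by move=> v Av; rewrite mevalZ mevalM HA // !mulr0 meval0.
Qed.

(** A monomial is determined by the set of its large exponents, by its small exponents, and by at
    most [l] large values. Only the last depend on [s], so there are [O(s ^ l)] such monomials. *)
Lemma few_large_exponents_enum n b l :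
  exists T : finType, forall s, exists f : T * l.-tuple 'I_s -> 'X_{1..n},
  forall m : 'X_{1..n},
    (#|[pred i | b <= m i]| <= l)%N -> (mdeg m < s)%N -> exists t, f t = m.
Proof.
exists ({ffun 'I_n -> 'I_b.+1} * {set 'I_n})%type => s.
exists (fun t : {ffun 'I_n -> 'I_b.+1} * {set 'I_n} * l.-tuple 'I_s =>
  [multinom if i \in t.1.2 then nth 0%N (map val t.2) (index i (enum t.1.2))
            else val (t.1.1 i) | i < n]).
move=> m ml ms; pose D := [set i | (b <= m i)%N]%SET.
have mis i : (m i < s)%N.
  by apply: leq_ltn_trans ms; rewrite mdegE (bigD1 i) //= leq_addr.
pose v := [tuple if insub (nth 0%N [seq m i | i <- enum D] j) is Some o then o
  else Ordinal (leq_ltn_trans (leq0n _) ms) | j < l].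
exists ([ffun i => inord (m i)], D, v); apply/mnmP => i; rewrite mnmE.
case: ifPn => [iD|]; last first.
  by rewrite inE -ltnNge => mib; rewrite ffunE /= inordK // ltnW.
have lt_i : (index i (enum D) < l)%N.
  by apply: leq_trans ml; rewrite -cardsE cardE index_mem mem_enum.
rewrite (nth_map (Ordinal (mis i))) ?size_tuple //.
rewrite (nth_map (Ordinal lt_i)) ?size_enum_ord // nth_enum_ord //.
rewrite (nth_map i) ?index_mem ?mem_enum // nth_index ?mem_enum //.
by rewrite insubT.
Qed.


Section RenameVariables.
Context (K : fieldType) (n k : nat) (f : 'I_k -> 'I_n).

(** The substitution of ['X_(f l)] for ['X_l], described on exponents so that the support of the
    result can be controlled. *)
Definition rename_monomial (m : 'X_{1..k}) : 'X_{1..n} :=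
  [multinom (\sum_(l | f l == i) m l)%N | i < n].

Definition rename_vars (h : {mpoly K[k]}) : {mpoly K[n]} :=
  \sum_(m <- msupp h) h@_m *: 'X_[rename_monomial m].

Lemma meval_rename (h : {mpoly K[k]}) (v : 'I_n -> K) :
  (rename_vars h).@[v] = h.@[v \o f].
Proof.
rewrite raddf_sum /= mevalE; apply: eq_bigr => m _.
rewrite mevalZ mevalX; congr (_ * _).
rewrite [RHS](partition_big f xpredT) //=; apply: eq_bigr => i _.
rewrite mnmE expr_sum; apply: eq_bigr => l /eqP <- //.
Qed.

Lemma msupp_rename (h : {mpoly K[k]}) m : m \in msupp (rename_vars h) ->
  forall i, i \notin codom f -> m i = 0%N.
Proof.
move=> mh i fi; apply/eqP; apply: contraLR mh => mi.
rewrite -mcoeff_eq0 raddf_sum /= big1 // => l _.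
rewrite mcoeffZ mcoeffX; case: eqP => [e|]; last by rewrite mulr0.
case/negP: mi; rewrite -e mnmE big1 // => j /eqP fj.
by rewrite -fj codom_f in fi.
Qed.

Lemma rename_neq0 (h : {mpoly K[k]}) :
  injective f -> h != 0 -> rename_vars h != 0.
Proof.
move=> f_inj; apply: contra_neq => h0.
have ren_f m l : rename_monomial m (f l) = m l.
  by rewrite mnmE (big_pred1 l) // => j; rewrite /= (inj_eq f_inj).
have ren_inj : injective rename_monomial.
  by move=> m m' e; apply/mnmP => l; rewrite -!ren_f e.
apply/mpolyP => m; rewrite mcoeff0.
have [mh|] := boolP (m \in msupp h); last by rewrite -mcoeff_eq0 => /eqP.
have := congr1 (mcoeff (rename_monomial m)) h0.
rewrite mcoeff0 raddf_sum (bigD1_seq m) ?msupp_uniq //= big1.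
  by rewrite addr0 mcoeffZ mcoeffX eqxx mulr1.
by move=> l /negPf lm; rewrite mcoeffZ mcoeffX (inj_eq ren_inj) lm mulr0.
Qed.

End RenameVariables.

(* Otherwise every set of k variables supports a relation H on A, and modulo the
   ideal of A only monomials with fewer than k exponents >= b are needed.  There
   are O(s^(k-1)) of these in degree < s, too few for the e^k products of the q_i
   with exponents < e, whose degree is less than s = O(e). *)
Lemma alg_indep_coordinates (K : fieldType) (X : Type) (A : set X) n k
    (x : 'I_n -> X -> K) (q : 'I_k -> {mpoly K[n]}) :
  alg_indep A (fun i v => (q i).@[x^~ v]) ->
  exists f : {ffun 'I_k -> 'I_n}, alg_indep A (fun l => x (f l)).
Proof.
case: k q => [|l] q q_indep.
  have f : {ffun 'I_0 -> 'I_n} by apply: finfun; case.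
  exists f; rewrite [X in alg_indep A X](_ : _ = fun i v => (q i).@[x^~ v]) //.
  by apply/funext => -[].
apply: contrapT => /forallNP no_f.
have /choice[h hP] (f : {ffun 'I_l.+1 -> 'I_n}) : exists h : {mpoly K[l.+1]},
    h != 0 /\ forall v, A v -> h.@[fun i => x (f i) v] = 0.
  have /existsNP[h /not_implyP[hA /eqP h0]] := no_f f.
  by exists h.
pose H (f : {ffun 'I_l.+1 -> 'I_n}) := rename_vars f (h f).
(* [b] exceeds every exponent of every [H f]. Hence, for injective [f], [mlead (H f)] divides each
   monomial whose exponents on the image of [f] are at least [b]. *)
pose b := \max_f msize (H f).
have [T enumT] := few_large_exponents_enum n b l.
pose N := \max_i msize (q i).
have [e e_gt0 lt_e] := pow_lt_exists #|T| (l.+1 * N).+1 (ltnSn l).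
set s := ((_.+1) * e)%N in lt_e; have [mon monP] := enumT s.
pose std (m : 'X_{1..n}) := (#|[pred i | b <= m i]| <= l)%N.
have nstd m : ~~ std m -> exists2 G : {mpoly K[n]},
     G != 0 /\ (mlead G <= m)%MM & forall v, A v -> G.@[x^~ v] = 0.
  rewrite -ltnNge => lt_l.
  pose f := [ffun j : 'I_l.+1 => enum_val (widen_ord lt_l j)].
  have f_inj : injective f.
    by move=> i j; rewrite !ffunE => /enum_val_inj /(congr1 val) /= /val_inj.
  have [hf0 hf] := hP f.
  exists (H f) => [|v Av]; last by rewrite meval_rename; exact: hf.
  have Hf0 : H f != 0 by apply: rename_neq0.
  split=> //; apply/mnm_lepP => i.
  have [/codomP[j ->]|fi] := boolP (i \in codom f); last first.
    by rewrite (msupp_rename (mlead_supp Hf0)).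
  apply: (@leq_trans b); last first.
    by rewrite ffunE; have := enum_valP (widen_ord lt_l j).
  apply: leq_trans (leq_bigmax f); rewrite -mlead_deg //.
  by rewrite mdegE (bigD1 (f j)) //= ltnW // ltnS leq_addr.
have /choice[r rP] (a : {ffun 'I_l.+1 -> 'I_e}) : exists r : {mpoly K[n]},
    [/\ {in msupp r, forall m, std m}, (msize r <= s)%N &
      forall v, A v -> (\prod_i q i ^+ a i).@[x^~ v] = r.@[x^~ v]].
  apply: standard_reduction nstd _ _; apply: msize_monomial_deg => // i.
  by rewrite leqW // /N leq_bigmax.
have [|c [a ca] cM] := kernel_exists (fun a j => (r a)@_(mon j)).
  by rewrite card_prod card_tuple card_ffun !card_ord.
move/eqP: ca; apply; apply: (alg_indep_monomials q_indep) => v Av.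
have r0 : \sum_a c a *: r a = 0.
  apply/mpolyP => m; rewrite mcoeff0 raddf_sum /=.
  have [[j <-]|nj] := EM (exists j, mon j = m).
    by rewrite -[RHS](cM j); apply: eq_bigr => i _; rewrite mcoeffZ.
  rewrite big1 // => i _; rewrite mcoeffZ.
  have [mr|] := boolP (m \in msupp (r i)); last first.
    by rewrite -mcoeff_eq0 => /eqP ->; rewrite mulr0.
  have [/(_ _ mr) stdm rs _] := rP i.
  case: nj; apply: monP => //; exact: leq_trans (msize_mdeg_lt mr) rs.
rewrite -[RHS](meval0 (x^~ v)) -r0 raddf_sum; apply: eq_bigr => i _ /=.
rewrite mevalZ; have [_ _ <- //] := rP i.
rewrite rmorph_prod; congr (_ * _); apply: eq_bigr => j _.
by rewrite rmorphXn.
Qed.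

(** * The dimension of the whole space *)

Section FullSpace.
Context (K : closedFieldType) (V : vectType K).

Lemma meval_line n (f : {mpoly K[n]}) (a b : 'I_n -> K) :
  exists p : {poly K}, forall t, p.[t] = f.@[fun i => a i + t * b i].
Proof.
exists (\sum_(m <- msupp f) f@_m *: \prod_i ((a i)%:P + b i *: 'X) ^+ m i) => t.
rewrite horner_sum mevalE; apply: eq_bigr => m _.
rewrite hornerZ horner_prod; congr (_ * _); apply: eq_bigr => i _.
by rewrite horner_exp !hornerE mulrC.
Qed.

Lemma coords_linear (v w : V) t i :
  coords (v + t *: w) i = coords v i + t * coords w i.
Proof. by rewrite /coords linearD linearZ. Qed.

Let flag i : set V :=
  [set v | forall j : 'I_(\dim {:V}), (i <= j)%N -> coords v j = 0].

Let flag_line i v w t : flag i v -> flag i w -> flag i (v + t *: (w - v)).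
Proof.
move=> vi wi j ij; rewrite coords_linear -scaleN1r coords_linear.
by rewrite vi // wi // mulr0 addr0 mulr0 addr0.
Qed.

(** If two proper closed subsets covered [flag i], take a point outside each and a polynomial
    separating it. On the line through both points the two polynomials are nonzero in one variable,
    so some parameter is a root of neither. *)
Let flag_irr i : irreducible_closed (flag i).
Proof.
split.
- exists [set f | exists2 j : 'I_(\dim {:V}), (i <= j)%N & f = 'X_j].
  apply/seteqP; split=> [v vi f [j ij ->]|v vi j ij].
    by rewrite mevalXU vi.
  by rewrite -(mevalXU (coords v) j); apply: vi; exists j.
- by exists 0 => j _; rewrite /coords linear0.
move=> A B algA algB YE; apply: contrapT => /not_orP[YA YB].
have [v Yv Av] : exists2 v, flag i v & ~ A v.
  apply: contrapT => nv; apply: YA; apply/seteqP; split=> [v Yv|v Av].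
    by apply: contrapT => Av; apply: nv; exists v.
  by rewrite YE; left.
have [w Yw Bw] : exists2 w, flag i w & ~ B w.
  apply: contrapT => nv; apply: YB; apply/seteqP; split=> [w Yw|w Bw].
    by apply: contrapT => Bw; apply: nv; exists w.
  by rewrite YE; right.
have [f fA fv] := algebraic_separated algA Av.
have [g gB gw] := algebraic_separated algB Bw.
have [p pE] := meval_line f (coords v) (coords (w - v)).
have [q qE] := meval_line g (coords v) (coords (w - v)).
have lineE (h : {mpoly K[\dim {:V}]}) t :
    h.@[fun i => coords v i + t * coords (w - v) i] =
    h.@[coords (v + t *: (w - v))].
  by apply: meval_eq => j; rewrite coords_linear.
have p0 : p != 0.
  apply: contraNneq fv => p0; have := pE 0.
  by rewrite lineE scale0r addr0 => <-; rewrite p0 horner0.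
have q0 : q != 0.
  apply: contraNneq gw => q0; have := qE 1.
  by rewrite lineE scale1r addrC subrK => <-; rewrite q0 horner0.
have /closed_nonrootP[t] := mulf_neq0 p0 q0.
case/negP; rewrite rootM !rootE pE qE !lineE.
have : (A `|` B) (v + t *: (w - v)) by rewrite -YE; exact: flag_line.
by case=> [/fA ->|/gB ->]; rewrite eqxx ?orbT.
Qed.

Lemma dim_geq_setT : dim_geq [set: V] (\dim {:V}).
Proof.
exists flag; split=> [i _|i iD]; first by split=> //; exact: flag_irr.
split=> [v vi j ij|/(_ (vbasis {:V})`_i)]; first by apply: vi; exact: ltnW.
have coordE (j : 'I_(\dim {:V})) :
    coords (vbasis {:V})`_i j = (Ordinal iD == j)%:R.
  rewrite /coords -[i]/(val (Ordinal iD)) coord_free //.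
  exact: basis_free (vbasisP _).
have bi : flag i.+1 (vbasis {:V})`_i.
  by move=> j ij; rewrite coordE; case: eqP ij => // <-; rewrite ltnn.
move=> /(_ bi (Ordinal iD) (leqnn _)) /eqP.
by rewrite coordE eqxx oner_eq0.
Qed.

End FullSpace.

(** * Finite covers and polynomial functions *)

(** If each [B i] carried a nonzero relation, the product of these relations would be a nonzero
    relation on [A]. *)
Lemma alg_indep_cover (K : fieldType) (X : Type) (I : finType) (A : set X)
    (B : I -> set X) k (u : 'I_k -> X -> K) :
  (forall x, A x -> exists i, B i x) -> alg_indep A u ->
  exists i, alg_indep (B i) u.
Proof.
move=> AB u_indep; apply: contrapT => /forallNP nB.
have /choice[h hP] i : exists h : {mpoly K[k]},
    h != 0 /\ forall x, B i x -> h.@[u^~ x] = 0.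
  by have /existsNP[h /not_implyP[hB /eqP h0]] := nB i; exists h.
have /eqP : \prod_i h i = 0.
  apply: u_indep => x /AB[i Bx].
  by rewrite rmorph_prod (bigD1 i) //= (hP i).2 // mul0r.
by apply/negP/prodf_neq0 => i _; have [] := hP i.
Qed.

Section PolynomialFunctions.
Context (K : fieldType) (m : nat).
Implicit Types F G : ('I_m -> K) -> K.

Definition polyfun F : Prop := exists q : {mpoly K[m]}, forall t, F t = q.@[t].

Lemma polyfun_cst c : polyfun (fun=> c).
Proof. by exists c%:MP => t; rewrite mevalC. Qed.

Lemma polyfun_var i : polyfun (fun t => t i).
Proof. by exists 'X_i => t; rewrite mevalXU. Qed.

Lemma polyfunD F G : polyfun F -> polyfun G -> polyfun (fun t => F t + G t).
Proof. by move=> [p pE] [q qE]; exists (p + q) => t; rewrite mevalD pE qE. Qed.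

Lemma polyfunM F G : polyfun F -> polyfun G -> polyfun (fun t => F t * G t).
Proof. by move=> [p pE] [q qE]; exists (p * q) => t; rewrite mevalM pE qE. Qed.

Lemma polyfunN F : polyfun F -> polyfun (fun t => - F t).
Proof. by move=> [p pE]; exists (- p) => t; rewrite mevalN pE. Qed.

Lemma polyfun_sum (I : finType) (P : pred I) (F : I -> ('I_m -> K) -> K) :
  (forall i, polyfun (F i)) -> polyfun (fun t => \sum_(i | P i) F i t).
Proof.
move=> /choice[q qE]; exists (\sum_(i | P i) q i) => t.
by rewrite raddf_sum; apply: eq_bigr => i _.
Qed.

Lemma polyfun_meval k (h : {mpoly K[k]}) (u : 'I_k -> ('I_m -> K) -> K) :
  (forall i, polyfun (u i)) -> polyfun (fun t => h.@[u^~ t]).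
Proof.
move=> /choice[q qE]; exists (h \mPo [tuple q i | i < k]) => t.
by rewrite comp_mpoly_meval; apply: meval_eq => i; rewrite tnth_mktuple.
Qed.

End PolynomialFunctions.

(** * Charts of the incidence set *)

Section Homogeneous.
Context (K : fieldType) (n : nat).

Lemma meval_dhomog d (p : {mpoly K[n]}) a (y : 'I_n -> K) :
  p \is d.-homog -> p.@[fun i => a * y i] = a ^+ d * p.@[y].
Proof.
move=> /dhomogP ph; rewrite !mevalE mulr_sumr big_seq [RHS]big_seq.
apply: eq_bigr => m /ph /= <-; rewrite mulrCA mdegE expr_sum -big_split.
by congr (_ * _); apply: eq_bigr => i _; rewrite exprMn.
Qed.

Lemma dhomog_mderiv d (p : {mpoly K[n]}) k :
  p \is d.-homog -> p^`M(k) \is d.-1.-homog.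
Proof.
move=> /dhomogP ph; apply/dhomogP => m.
rewrite mcoeff_msupp mcoeff_mderiv => pm.
have /ph <- : (m + U_(k))%MM \in msupp p.
  by rewrite mcoeff_msupp; apply: contraNneq pm => ->; rewrite mul0rn.
by rewrite /= mdegD mdeg1 addn1.
Qed.

End Homogeneous.

Section Chart.
Context (K : fieldType) (n d R : nat) (i0 : 'I_R) (j : 'I_n).
Hypothesis d_gt0 : (0 < d)%N.
Hypothesis d_neq0 : d%:R != 0 :> K.
Local Notation V := (polymap n K d R).

(** The [k]-th entry of the covector [l] times the Jacobian matrix of [P] at [y]. *)
Definition lagrange (P : V) (l : 'I_R -> K) (y : 'I_n -> K) k : K :=
  \sum_i l i * ((val (P i))^`M(k)).@[y].

Lemma lagrangeD P Q l y k :
  lagrange (P + Q) l y k = lagrange P l y k + lagrange Q l y k.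
Proof.
rewrite -big_split; apply: eq_bigr => i _.
by rewrite ffunE /= mderivD mevalD mulrDr.
Qed.

Lemma lagrangeZ a P l y k : lagrange (a *: P) l y k = a * lagrange P l y k.
Proof.
rewrite mulr_sumr; apply: eq_bigr => i _.
by rewrite ffunE /= mderivZ mevalZ mulrCA.
Qed.

Lemma lagrange0 l y k : lagrange 0 l y k = 0.
Proof. by rewrite -[0 : V](scale0r 0) lagrangeZ mul0r. Qed.

Lemma lagrange_sum (I : finType) (c : I -> K) (P : I -> V) l y k :
  lagrange (\sum_i c i *: P i) l y k = \sum_i c i * lagrange (P i) l y k.
Proof.
rewrite (big_morph (fun P => lagrange P l y k)
  (id1 := 0) (op1 := +%R)) => [|P1 P2|].
- by apply: eq_bigr => i _; rewrite lagrangeZ.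
- exact: lagrangeD.
- exact: lagrange0.
Qed.

Lemma corner_homog k : ('X_j ^+ d.-1 * 'X_k : {mpoly K[n]}) \is d.-homog.
Proof.
rewrite -{2}(prednK d_gt0) -addn1 dhomogM //; last by rewrite dhomogX /= mdeg1.
by rewrite -[X in X.-homog]mul1n dhomogMn // dhomogX /= mdeg1.
Qed.

Definition corner k : V :=
  [ffun i => if i == i0 then DHomog (corner_homog k) else 0].

(** The product rule at [y j = 1]. As a matrix in [k] and [k'] this is the identity plus [d.-1]
    times [y] in row [j], of determinant [d]. *)
Lemma lagrange_corner k' l y k : l i0 = 1 -> y j = 1 ->
  lagrange (corner k') l y k = (k == j)%:R * d.-1%:R * y k' + (k == k')%:R.
Proof.
move=> li yj; rewrite /lagrange (bigD1 i0) //= big1 ?addr0; last first.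
  by move=> i /negPf ii0; rewrite ffunE ii0 mderiv0 meval0 mulr0.
rewrite li mul1r ffunE eqxx /= mderivM mevalD !mevalM mevalXU.
have -> : ('X_j ^+ d.-1).@[y] = 1 :> K by rewrite rmorphXn /= mevalXU yj expr1n.
rewrite mul1r mpolyXn !mderivX !mevalZ mnm1E mulmnE mnm1E !mevalX.
rewrite [\prod_i y i ^+ (U_(j) *+ _ - _)%MM i]big1; last first.
  move=> i _; rewrite mnmBE mulmnE !mnm1E.
  have [<-|] := eqVneq j i; first by rewrite yj expr1n.
  by rewrite mul0n sub0n expr0.
rewrite mulr1 natrM [k' == k]eq_sym [j == k]eq_sym; congr (_ * _ + _).
have [->|] := eqVneq k k'; last by rewrite mul0r.
by rewrite big1 ?mulr1 // => i _; rewrite mnmBE subnn expr0.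
Qed.

(* Solution c of the equations [lagrange P l y k = 0], k < n, where
   P = Q + sum_k c_k corner_k and s = lagrange Q l y. *)
Definition solve (s y : 'I_n -> K) k : K :=
  if k == j then (d.-1%:R * (\sum_(k' | k' != j) y k' * s k') - s j) / d%:R
  else - s k.

(** The equations with [k != j] give [c k] directly. Substituted into the [j]-th one, where [c j]
    has coefficient [d.-1 + 1 = d], they give [c j]. *)
Lemma corner_coef (P Q : V) c l y :
  l i0 = 1 -> y j = 1 -> P = Q + \sum_k c k *: corner k ->
  (forall k, lagrange P l y k = 0) ->
  forall k, c k = solve (lagrange Q l y) y k.
Proof.
move=> li yj PE Ply.
have eqk k : lagrange Q l y k +
    ((k == j)%:R * d.-1%:R * (\sum_k' c k' * y k') + c k) = 0.
  rewrite -[RHS](Ply k) PE lagrangeD lagrange_sum; congr (_ + _).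
  under [RHS]eq_bigr do rewrite lagrange_corner // mulrDr.
  rewrite big_split mulr_sumr /=; congr (_ + _).
    by apply: eq_bigr => k' _; rewrite mulrCA.
  rewrite (bigD1 k) //= eqxx mulr1 big1 ?addr0 // => k' /negPf.
  by rewrite eq_sym => ->; rewrite mulr0.
have ck k : k != j -> c k = - lagrange Q l y k.
  move=> /negPf kj; have := eqk k.
  by rewrite kj !mul0r add0r => /addr0_eq ->.
move=> k; rewrite /solve; case: (eqVneq k j) => [->|/ck //].
apply: (mulIf d_neq0); rewrite divfK //.
have := eqk j; rewrite eqxx mul1r (bigD1 j) //= yj mulr1 => e.
under eq_bigr => k' k'j do rewrite -[lagrange Q l y k']opprK -ck // mulrN mulrC.
rewrite sumrN -[in d%:R](prednK d_gt0) -[d.-1.+1]addn1 natrD.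
set S := \sum_(_ | _) _ in e *.
by move/eqP: e; rewrite addr_eq0 => /eqP ->; ring.
Qed.

(** A linear relation among the corners is the case [P = Q = 0] of [corner_coef], and [solve]
    returns 0 on zero data. *)
Lemma corner_free : free [tuple corner k | k < n].
Proof.
apply/freeP => c c0 k.
have -> := @corner_coef 0 0 c (fun=> 1) (fun k => (k == j)%:R);
  rewrite ?eqxx //.
- rewrite /solve !lagrange0 oppr0 big1 ?mulr0 ?add0r ?mul0r ?if_same // => k' _.
  by rewrite lagrange0 mulr0.
- rewrite add0r -[LHS]c0; apply: eq_bigr => i _.
  by rewrite -tnth_nth tnth_mktuple.
- by move=> k'; rewrite lagrange0.
Qed.

Lemma leq_dim_polymap : (n <= \dim {:V})%N.
Proof.
apply: leq_trans (dimvS (subvf <<[tuple corner k | k < n]>>%VS)).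
by rewrite (eqnP corner_free) size_tuple.
Qed.

(** Equal to [\dim {:V} + R.-1] by [leq_dim_polymap]; the sum displays the three blocks of
    parameters. *)
Let m := (n + R.-1 + (\dim {:V} - n))%N.

(* The parameters are y (whose j-th slot, as y j = 1, holds the scale instead),
   the l i with i != i0, and the coordinates of Q in a complement of the corners. *)
Lemma incidence_chart :
  exists (Pc : ('I_m -> K) -> V) (xc : 'I_n -> ('I_m -> K) -> K),
  [/\ forall i, polyfun (fun t => coords (Pc t) i),
      forall k, polyfun (xc k) &
      forall P l y a, l i0 != 0 -> y j != 0 ->
        (forall k, lagrange P l y k = 0) ->
        exists t, Pc t = P /\ forall k, xc k t = a * y k].
Proof.
pose U : {vspace V} := <<[tuple corner k | k < n]>>%VS.
have := vbasisP U^C%VS; move: (vbasis _).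
rewrite dimv_compl (eqnP corner_free) size_tuple => b /span_basis bP.
pose yc (t : 'I_m -> K) k := if k == j then 1 else t (lshift _ (lshift _ k)).
pose lc (t : 'I_m -> K) i :=
  if unlift i0 i is Some i' then t (lshift _ (rshift _ i')) else 1.
pose Qc (t : 'I_m -> K) := \sum_w t (rshift _ w) *: b`_w.
pose cc t k := solve (lagrange (Qc t) (lc t) (yc t)) (yc t) k.
have yc_poly k : polyfun (yc^~ k).
  by rewrite /yc; case: (k == j); [exact: polyfun_cst | exact: polyfun_var].
have lc_poly i : polyfun (lc^~ i).
  rewrite /lc; case: unlift => [i'|]; last exact: polyfun_cst.
  exact: polyfun_var.
have lQ_poly k : polyfun (fun t => lagrange (Qc t) (lc t) (yc t) k).
  under [X in polyfun X]funext do rewrite lagrange_sum.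
  apply: polyfun_sum => w; apply: polyfunM; first exact: polyfun_var.
  apply: polyfun_sum => i; apply: polyfunM => //; exact: polyfun_meval.
have cc_poly k : polyfun (cc^~ k).
  rewrite /cc /solve; case: (k == j); last exact: polyfunN.
  apply: polyfunM; last exact: polyfun_cst.
  apply: polyfunD; last exact: polyfunN.
  apply: polyfunM; first exact: polyfun_cst.
  by apply: polyfun_sum => k'; exact: polyfunM.
exists (fun t => Qc t + \sum_k cc t k *: corner k).
exists (fun k t => t (lshift _ (lshift _ j)) * yc t k).
split=> [i|k|P l y a li yj Ply].
- rewrite /coords; under [X in polyfun X]funext do rewrite linearD !linear_sum.
  apply: polyfunD; apply: polyfun_sum => w.
    under [X in polyfun X]funext do rewrite linearZ.
    apply: polyfunM; [exact: polyfun_var | exact: polyfun_cst].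
  under [X in polyfun X]funext do rewrite linearZ.
  by apply: polyfunM => //; exact: polyfun_cst.
- by apply: polyfunM => //; exact: polyfun_var.
have : P \in (U + U^C)%VS by rewrite addv_complf memvf.
case/memv_addP => [u uU [Q QW PE]].
have [c uE] : exists c : 'I_n -> K, u = \sum_k c k *: corner k.
  exists (fun k => coord [tuple corner k | k < n] k u).
  rewrite {1}(coord_span uU); apply: eq_bigr => k _.
  by rewrite -tnth_nth tnth_mktuple.
have [w QE] : exists w : 'I_(\dim {:V} - n) -> K, Q = \sum_i w i *: b`_i.
  exists (fun i => coord b i Q); apply: coord_span; by rewrite bP.
(* [y] is divided by [y j] and [l] by [l i0]. With [a * y j] as the scale, [xc k t] is
   [a * y j * (y k / y j) = a * y k]. *)
pose t (i : 'I_m) : K := match split i with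
  | inl i1 => match split i1 with
     | inl k => if k == j then a * y j else y k / y j
     | inr i' => l (lift i0 i') / l i0
     end
  | inr i2 => w i2
  end.
exists t.
have tyE k : yc t k = (y j)^-1 * y k.
  rewrite /yc /t (unsplitK (inl (lshift _ k))) (unsplitK (inl k)) [RHS]mulrC.
  by case: eqVneq => [->|_ //]; rewrite divff.
have tlE i : lc t i = (l i0)^-1 * l i.
  rewrite /lc [RHS]mulrC; case: unliftP => [i'|] ->; last by rewrite divff.
  by rewrite /t (unsplitK (inl (rshift _ i'))) (unsplitK (inr i')).
have tQE : Qc t = Q.
  by rewrite QE; apply: eq_bigr => i _; rewrite /t (unsplitK (inr i)).
(* The equations survive the normalisation, being linear in [l] and homogeneous of degree [d.-1] in
   [y]. *)
have lagr0 k : lagrange P (lc t) (yc t) k = 0.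
  rewrite -[RHS](mulr0 ((l i0)^-1 * (y j)^-1 ^+ d.-1)) -[in RHS](Ply k).
  rewrite mulr_sumr.
  apply: eq_bigr => i _; rewrite tlE (meval_eq _ tyE) mulrACA; congr (_ * _).
  exact/meval_dhomog/dhomog_mderiv/dhomog_is_dhomog.
split=> [|k]; last first.
  rewrite tyE /t (unsplitK (inl (lshift _ j))) (unsplitK (inl j)) eqxx.
  by rewrite mulrA mulfK.
rewrite PE tQE addrC; congr (_ + _); rewrite uE; apply: eq_bigr => k _.
congr (_ *: _); apply/esym; apply: corner_coef lagr0 _.
- by rewrite tlE mulVf.
- by rewrite tyE mulVf.
- by rewrite tQE PE uE addrC.
Qed.

End Chart.

(** * Zariski closure and the dimension bound *)

Section Closure.
Context (K : fieldType) (V : vectType K).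
Implicit Types A : set V.

Definition zariski_closure A : set V :=
  [set v | forall f : {mpoly K[\dim {:V}]},
    (forall w, A w -> f.@[coords w] = 0) -> f.@[coords v] = 0].

Lemma algebraic_zariski_closure A : algebraic (zariski_closure A).
Proof. by exists [set f | forall w, A w -> f.@[coords w] = 0]. Qed.

Lemma sub_zariski_closure A : A `<=` zariski_closure A.
Proof. by move=> v Av f; apply. Qed.

(** A relation among the [u i] on [A] is a polynomial in the coordinates that vanishes on [A], hence
    on the closure. *)
Lemma alg_indep_zariski_closure A k (u : 'I_k -> {mpoly K[\dim {:V}]}) :
  alg_indep (zariski_closure A) (fun i v => (u i).@[coords v]) ->
  alg_indep A (fun i v => (u i).@[coords v]).
Proof.
move=> u_indep h h0; apply: u_indep => v Av.
have uE w : h.@[fun i => (u i).@[coords w]] =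
    (h \mPo [tuple u i | i < k]).@[coords w].
  by rewrite comp_mpoly_meval; apply: meval_eq => i; rewrite tnth_mktuple.
by rewrite uE; apply: Av => w Aw; rewrite -uE h0.
Qed.

End Closure.

Lemma dim_geq_coordinates (K : fieldType) n (A : set 'rV[K]_n) k :
  dim_geq A k ->
  exists f : {ffun 'I_k -> 'I_n},
    alg_indep A (fun l (v : 'rV[K]_n) => v 0 (f l)).
Proof.
move=> /dim_geq_alg_indep[u u_indep].
(* The linear change from matrix entries to the basis underlying [coords]. *)
pose c l : {mpoly K[n]} := \sum_j coords (delta_mx 0 j : 'rV[K]_n) l *: 'X_j.
apply: (@alg_indep_coordinates K 'rV[K]_n A n k (fun j v => v 0 j)
  (fun i => u i \mPo [tuple c l | l < \dim {:'rV[K]_n}])).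
move: u_indep; congr (alg_indep A _); apply/funext => i; apply/funext => v.
rewrite comp_mpoly_meval; apply: meval_eq => l; rewrite tnth_mktuple.
rewrite /c raddf_sum /= {1}[v]row_sum_delta /coords linear_sum.
apply: eq_bigr => j _.
by rewrite mevalZ mevalXU linearZ mulrC.
Qed.

Section SingularLocus.
Context (K : fieldType) (n d R : nat).
Hypothesis d_gt0 : (0 < d)%N.
Hypothesis d_neq0 : d%:R != 0 :> K.
Local Notation V := (polymap n K d R).

Lemma Sstar_lagrange (P : V) x : Sstar P x ->
  exists l i, l i != 0 /\ forall k, lagrange P l (x 0) k = 0.
Proof.
move=> Px; have : kermx (jacobian P x) != 0.
  by rewrite -mxrank_eq0 mxrank_ker subn_eq0 -ltnNge.
move/rowV0Pn => [v /sub_kermxP vJ /rV0Pn[i vi]].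
exists (v 0), i; split=> // k; have /rowP/(_ k) := vJ.
rewrite !mxE => e; rewrite -[RHS]e; apply: eq_bigr => l _.
by rewrite mxE.
Qed.

Lemma singular_locus_bound L k (u : 'I_k -> {mpoly K[\dim {:V}]}) : (0 < L)%N ->
  alg_indep [set P : V | dim_geq (Sstar P) L] (fun i P => (u i).@[coords P]) ->
  (k + L <= n + R.-1 + (\dim {:V} - n))%N.
Proof.
move=> L_gt0 /(alg_indep_cover (B := fun f : {ffun 'I_L -> 'I_n} =>
  [set P : V | alg_indep (Sstar P) (fun l (x : 'rV_n) => x 0 (f l))])).
case=> [P /dim_geq_coordinates //|f u_indep]; rewrite leqNgt; apply/negP.
set m := (n + R.-1 + _)%N => lt_m.
pose A : set (V * 'rV[K]_n) := [set Px |
  alg_indep (Sstar Px.1) (fun l (x : 'rV_n) => x 0 (f l)) /\ Sstar Px.1 Px.2].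
have /choice[q qP] (c : 'I_R * 'I_n) :
    exists q : ('I_k -> {mpoly K[m]}) * ('I_L -> {mpoly K[m]}),
    forall P l (y : 'I_n -> K) a, l c.1 != 0 -> y c.2 != 0 ->
    (forall k, lagrange P l y k = 0) ->
    exists t, (forall i, (u i).@[coords P] = (q.1 i).@[t]) /\
      forall i, a * y (f i) = (q.2 i).@[t].
  have [Pc [xc [Pc_poly xc_poly PxE]]] := incidence_chart c.1 c.2 d_gt0 d_neq0.
  have /choice[q1 q1E] i := polyfun_meval (u i) Pc_poly.
  have /choice[q2 q2E] i := xc_poly (f i).
  exists (q1, q2) => P l y a li yj Py.
  have [t [PE xE]] := PxE P l y a li yj Py.
  by exists t; split=> i /=; rewrite -?q1E -?q2E ?PE ?xE.
pose N := maxn (\max_c \max_i msize ((q c).1 i))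
  (\max_c \max_i msize ((q c).2 i)).
(* The two inner summands bound the [u] part and the [x] part of a product; the outer successor
   absorbs the off-by-one in [msize_mul_deg]. *)
have [e e_gt0 lt_e] := pow_lt_exists #|{: 'I_R * 'I_n}|
  ((k * N).+1 + (L * N).+1).+1 lt_m.
pose I : finType := ({ffun 'I_k -> 'I_e} * {ffun 'I_L -> 'I_e})%type.
pose F (i : I) (Px : V * 'rV[K]_n) :=
  (\prod_j (u j).@[coords Px.1] ^+ i.1 j) * \prod_j Px.2 0 (f j) ^+ i.2 j.
pose qF c (i : I) := (\prod_j (q c).1 j ^+ i.1 j) * \prod_j (q c).2 j ^+ i.2 j.
have [c i|[P x] [/= Pf Px]||a [i ai] a0] := @charts_dependent K _ A _ I m
  (((k * N).+1 + (L * N).+1).+1 * e)%N F qF.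
- have le1 : (msize (\prod_j (q c).1 j ^+ i.1 j) <= (k * N).+1 * e)%N.
    apply: msize_monomial_deg => // j; apply: leqW; rewrite leq_max.
    by rewrite (leq_trans _ (leq_bigmax c)) // (leq_bigmax j).
  have le2 : (msize (\prod_j (q c).2 j ^+ i.2 j) <= (L * N).+1 * e)%N.
    apply: msize_monomial_deg => // j; apply: leqW; rewrite leq_max orbC.
    by rewrite (leq_trans _ (leq_bigmax c)) // (leq_bigmax j).
  apply: leq_trans (msize_mul_deg (leqW le1) (leqW le2)) _.
  by rewrite -mulnDl [leqRHS]mulSn -add1n leq_add2r.
- have [y [j [t [yj Py ytE]]]] : exists (y : 'rV[K]_n) j t,
      [/\ y 0 j != 0, Sstar P y & x = t *: y].
    (* At x = 0 the Jacobian may vanish whatever P is, so that case is reached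
       from another point of S_P^*, with scale 0. *)
    have [x0|/rV0Pn[j xj]] := eqVneq x 0; last first.
      by exists x, j, 1; rewrite scale1r.
    apply: contrapT => ny.
    (* Without such a point, the first chosen coordinate would vanish on [Sstar P], against
       independence. This is where [0 < L] enters. *)
    have /eqP[] : 'X_(Ordinal L_gt0) != 0 :> {mpoly K[L]}.
      by rewrite -msize_poly_eq0 msizeX.
    apply: Pf => y Py; rewrite mevalXU; apply: contrapT => /eqP yj.
    by apply: ny; exists y, (f (Ordinal L_gt0)), 0; rewrite scale0r.
  have [l [i [li Pl]]] := Sstar_lagrange Py.
  have [s [us xs]] := qP (i, j) P l (y 0) t li yj Pl.
  exists (i, j), s => b; rewrite rmorphM !rmorph_prod; congr (_ * _).
    by apply: eq_bigr => h _; rewrite rmorphXn /= us.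
  by apply: eq_bigr => h _; rewrite rmorphXn /= ytE mxE xs.
- by rewrite [#|I|]card_prod !card_ffun !card_ord -expnD.
move/eqP: ai; apply; case: i => i1 i2.
(* For fixed [P], independence on [Sstar P] kills the coefficient of each monomial in [x]. That
   coefficient is a polynomial in the [u i] at [P], so independence of the [u i] kills each
   [a (i1, i2)]. *)
apply: (alg_indep_monomials (c := fun i1 => a (i1, i2)) u_indep) => P /= Pf.
apply: (alg_indep_monomials (c := fun i2 => \sum_i1 a (i1, i2) * \prod_j _) Pf).
move=> x Px; rewrite -[RHS](a0 (P, x)) //.
under eq_bigr do rewrite mulr_suml.
rewrite exchange_big pair_big; apply: eq_bigr => -[b1 b2] _.
by rewrite mulrA.
Qed.

End SingularLocus.

Theorem proposition1
    (p : nat) (p_prime : prime p)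
    (K : closedFieldType) (iota : {rmorphism 'F_p -> K})
    (K_algebraic : integralRange iota)
    (d : nat) (d_gt0 : (0 < d)%N) (d_lt_p : (d < p)%N)
    (R L n : nat)
    (R_ge1 : (1 <= R)%N) (R_le_L : (R <= L)%N) (L_le_n : (L <= n)%N) :
  exists Z : set (polymap n K d R),
    [/\ algebraic Z,
        [set P : polymap n K d R | dim_geq (Sstar P) L] `<=` Z &
        codim_geq Z (L%:Z - (2 * R)%N%:Z + 2)].
Proof.
exists (zariski_closure [set P : polymap n K d R | dim_geq (Sstar P) L]).
split; [exact: algebraic_zariski_closure | exact: sub_zariski_closure |].
move=> k /dim_geq_alg_indep[u /alg_indep_zariski_closure u_indep].
exists (\dim {: polymap n K d R}); first exact: dim_geq_setT.
(* [K] has characteristic [p] through [iota], and [0 < d < p]. *)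
have d_neq0 : d%:R != 0 :> K.
  have pK : p \in [pchar K] by exact: (rmorph_pchar iota (pchar_Fp p_prime)).
  by rewrite -(dvdn_pcharf pK) gtnNdvd.
have n_le : (n <= \dim {: polymap n K d R})%N.
  have [i0 j] : 'I_R * 'I_n by split; [exists 0%N | exists 0%N; lia].
  exact: leq_dim_polymap i0 j d_gt0 d_neq0.
(* This gives codimension at least [L - R + 1], which is at least [L - 2R + 2] because [1 <= R]. *)
have := singular_locus_bound d_gt0 d_neq0 (leq_trans R_ge1 R_le_L) u_indep.
lia.
Qed.
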